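(* For every real $r>3$, $$\frac{1}{r^2-3}\;{}_2F_1\!\left(\tfrac13,\tfrac23;1;\ \frac{27(r^2-1)}{(r^2-3)^3}\right)=\frac{1}{(r-1)^{3/2}(r+3)^{1/2}}\;{}_2F_1\!\left(\tfrac12,\tfrac12;1;\ \frac{16r}{(r-1)^3(r+3)}\right).$$
   Context: The hypergeometric function is defined for $|z|<1$ by ${}_2F_1(\alpha,\beta;\gamma;z)=\sum_{n=0}^\infty\frac{(\alpha)_n(\beta)_n}{(\gamma)_n}\frac{z^n}{n!}$, where $(q)_0=1$ and $(q)_n=q(q+1)\cdots(q+n-1)$ for $n\ge1$. *)

(* Defs.v *)
From Stdlib Require Import Reals Factorial.
From Coquelicot Require Import Coquelicot.

Open Scope R_scope.

(* (q)_n = q (q+1) ... (q+n-1), the rising factorial. *)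
Fixpoint pochhammer (q : R) (n : nat) : R :=
  match n with
  | O => 1
  | S m => pochhammer q m * (q + INR m)
  end.

(* Gauss's 2F1 for real parameters and argument.  [Series] is total: the value
   is the sum of the hypergeometric series when |z| < 1 and c is not a
   nonpositive integer, and carries no meaning where the series diverges or a
   denominator vanishes. *)
Definition hyp2F1 (a b c z : R) : R :=
  Series (fun n : nat =>
    pochhammer a n * pochhammer b n / pochhammer c n * (z ^ n / INR (fact n))).

(* Main.v *)
Require Import Defs.
From Stdlib Require Import Reals Factorial Lra.
From Coquelicot Require Import Coquelicot.

Open Scope R_scope.

(** With [t = 1/r], which lies in [(0, 1/3)], both sides of the identity divided
    by [t^2] are pullbacks of the Gauss functions [A] (parameters [1/3, 2/3; 1])
    and [B] (parameters [1/2, 1/2; 1]), which have [c = 1] and [a + b = 1]: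
      [f(t) = A(x) / (1 - 3 t^2)], [x = 27 t^4 (1 - t^2) / (1 - 3 t^2)^3],
      [g(t) = B(z) / sqrt ((1 - t)^3 (1 + 3 t))],
                               [z = 16 t^3 / ((1 - t)^3 (1 + 3 t))].
    The Gauss equation reads [(y (1 - y) F')' = a b F], and the substitutions
    carry both instances of it to the same self-adjoint equation
      [(p y')' = Q y], [p = t (1 - t^2) (1 - 9 t^2)], [Q = 12 t (1 - 3 t^2)]
    ([pullback_solution], applied in [cubic_side] and [elliptic_side]).
    Hence the Wronskian expression [p (f' g - f g')] is constant.  Both solutions
    are regular at the singular point [t = 0], where [p] vanishes, so the
    constant is zero and [f / g] is constant ([regular_solutions_proportional]);
    its value at [t = 0] is [1].

    Since [1 - x = (1 - 9 t^2) / (1 - 3 t^2)^3] and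
    [1 - z = (1 + t)^3 (1 - 3 t) / ((1 - t)^3 (1 + 3 t))], both arguments stay in
    [[0, 1)] for [0 <= t < 1/3]. *)

(** * The Gauss equation for [c = 1] and [a + b = 1] *)

(** The Taylor coefficients of [hyp2F1 a b 1] at [0]. *)
Definition hyp_coef (a b : R) (n : nat) : R :=
  pochhammer a n * pochhammer b n / pochhammer 1 n / INR (fact n).

(** The derivative of [hyp2F1 a b 1] on the unit interval [|x| < 1], as a power
    series. *)
Definition hyp_deriv (a b x : R) : R := PSeries (PS_derive (hyp_coef a b)) x.

Lemma hyp2F1_PSeries (a b x : R) : hyp2F1 a b 1 x = PSeries (hyp_coef a b) x.
Proof.
  apply Series_ext; intros n; unfold hyp_coef, Rdiv; ring.
Qed.

Lemma pochhammer_1 (n : nat) : pochhammer 1 n = INR (fact n).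
Proof.
  induction n as [|n IH].
  - reflexivity.
  - rewrite fact_simpl, mult_INR, S_INR; simpl; rewrite IH; ring.
Qed.

Lemma pochhammer_bounds (a : R) (n : nat) :
  0 <= a <= 1 -> 0 <= pochhammer a n <= INR (fact n).
Proof.
  intros Ha; rewrite <- pochhammer_1; induction n as [|n IH]; simpl.
  - lra.
  - pose proof (pos_INR n); split.
    + apply Rmult_le_pos; lra.
    + apply Rmult_le_compat; lra.
Qed.

Lemma hyp_coef_bounds (a b : R) (n : nat) :
  0 <= a <= 1 -> 0 <= b <= 1 -> 0 <= hyp_coef a b n <= 1.
Proof.
  intros Ha Hb; unfold hyp_coef; rewrite pochhammer_1.
  pose proof (pochhammer_bounds a n Ha) as [A0 A1].
  pose proof (pochhammer_bounds b n Hb) as [B0 B1].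
  pose proof (INR_fact_lt_0 n) as F.
  replace (pochhammer a n * pochhammer b n / INR (fact n) / INR (fact n))
    with ((pochhammer a n / INR (fact n)) * (pochhammer b n / INR (fact n)))
    by (field; lra).
  assert (U : forall y, 0 <= y <= INR (fact n) -> 0 <= y / INR (fact n) <= 1).
  { intros y [Y0 Y1]; split.
    - apply Rdiv_le_0_compat; lra.
    - apply Rle_div_l; lra. }
  pose proof (U _ (conj A0 A1)); pose proof (U _ (conj B0 B1)); nra.
Qed.

(** When [a + b = 1] the factor [(n + a) (n + b)] of the coefficient recurrence
    is [n (n + 1) + a b]. *)
Lemma hyp_coef_rec (a b : R) (n : nat) :
  a + b = 1 ->
  INR (S n) * INR (S n) * hyp_coef a b (S n)
  = (INR n * INR (S n) + a * b) * hyp_coef a b n.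
Proof.
  intros Hab; unfold hyp_coef; rewrite !pochhammer_1, fact_simpl, mult_INR, S_INR.
  simpl pochhammer.
  pose proof (INR_fact_lt_0 n); pose proof (pos_INR n).
  replace b with (1 - a) by lra; field; lra.
Qed.

Lemma lt_CV_radius_of_bounded (c : nat -> R) (x : R) :
  (forall n, Rabs (c n) <= 1) -> Rabs x < 1 -> Rbar_lt (Rabs x) (CV_radius c).
Proof.
  intros Hc Hx; apply Rbar_lt_le_trans with (Finite 1); [exact Hx|].
  apply CV_radius_bounded; exists 1; intros n.
  rewrite pow1, Rmult_1_r; apply Hc.
Qed.

Section Gauss.

Variables a b : R.
Hypothesis Ha : 0 <= a <= 1.
Hypothesis Hb : 0 <= b <= 1.
Hypothesis Hab : a + b = 1.

Lemma hyp_coef_radius (x : R) :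
  Rabs x < 1 -> Rbar_lt (Rabs x) (CV_radius (hyp_coef a b)).
Proof.
  apply lt_CV_radius_of_bounded; intros n.
  pose proof (hyp_coef_bounds a b n Ha Hb); rewrite Rabs_pos_eq; lra.
Qed.

Lemma is_derive_hyp2F1 (x : R) :
  Rabs x < 1 -> is_derive (hyp2F1 a b 1) x (hyp_deriv a b x).
Proof.
  intros Hx; apply is_derive_ext with (PSeries (hyp_coef a b)).
  - intros y; symmetry; apply hyp2F1_PSeries.
  - apply is_derive_PSeries, hyp_coef_radius, Hx.
Qed.

(** The coefficients of [(1 - x) F'(x)], by the recurrence [hyp_coef_rec]. *)
Let flux_coef (n : nat) : R := a * b * hyp_coef a b n / INR (S n).

Lemma flux_coef_radius (x : R) :
  Rabs x < 1 -> Rbar_lt (Rabs x) (CV_radius flux_coef).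
Proof.
  apply lt_CV_radius_of_bounded; intros n; unfold flux_coef.
  pose proof (hyp_coef_bounds a b n Ha Hb).
  pose proof (pos_INR n); rewrite S_INR.
  assert (0 <= a * b <= 1) by nra.
  assert (0 <= a * b * hyp_coef a b n <= 1) by nra.
  rewrite Rabs_pos_eq.
  - apply Rle_div_l; lra.
  - apply Rdiv_le_0_compat; lra.
Qed.

Lemma flux_PSeries (x : R) :
  Rabs x < 1 -> x * (1 - x) * hyp_deriv a b x = PSeries (PS_incr_1 flux_coef) x.
Proof.
  intros Hx; rewrite PSeries_incr_1.
  assert (E : PSeries flux_coef x = (1 - x) * hyp_deriv a b x).
  { rewrite (PSeries_ext flux_coef (PS_minus (PS_derive (hyp_coef a b))
               (PS_incr_1 (PS_derive (hyp_coef a b))))).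
    - rewrite PSeries_minus, PSeries_incr_1.
      + unfold hyp_deriv; ring.
      + apply CV_radius_inside; rewrite CV_radius_derive.
        apply hyp_coef_radius, Hx.
      + apply CV_radius_inside; rewrite CV_radius_incr_1, CV_radius_derive.
        apply hyp_coef_radius, Hx.
    - intros n; unfold flux_coef, PS_minus, PS_plus, PS_opp, PS_incr_1, PS_derive.
      change plus with Rplus; change opp with Ropp.
      pose proof (hyp_coef_rec a b n Hab) as Rec.
      assert (Sn : INR (S n) <> 0) by (rewrite S_INR; pose proof (pos_INR n); lra).
      apply (Rmult_eq_reg_r (INR (S n))); [|exact Sn].
      unfold Rdiv at 1; rewrite Rmult_assoc, Rinv_l, Rmult_1_r by exact Sn.
      destruct n as [|n].
      + change zero with 0; simpl INR in *; lra.
      + lra. }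
  rewrite E; ring.
Qed.

(** The Gauss equation in self-adjoint form: [(x (1 - x) F')' = a b F]. *)
Lemma is_derive_flux (x : R) :
  Rabs x < 1 ->
  is_derive (fun y => y * (1 - y) * hyp_deriv a b y) x (a * b * hyp2F1 a b 1 x).
Proof.
  intros Hx; apply is_derive_ext_loc with (PSeries (PS_incr_1 flux_coef)).
  - assert (O : locally x (fun y => -1 < y < 1)).
    { apply Rabs_def2 in Hx.
      apply (open_and (fun y => -1 < y) (fun y => y < 1));
        [apply open_gt | apply open_lt | lra]. }
    revert O; apply filter_imp; intros y Hy; symmetry.
    apply flux_PSeries, Rabs_def1; lra.
  - rewrite hyp2F1_PSeries, <- PSeries_scal.
    rewrite (PSeries_ext _ (PS_derive (PS_incr_1 flux_coef))).
    + apply is_derive_PSeries; rewrite CV_radius_incr_1.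
      apply flux_coef_radius, Hx.
    + intros n; unfold PS_scal, PS_derive, PS_incr_1, flux_coef.
      change scal with Rmult; field.
      rewrite S_INR; pose proof (pos_INR n); lra.
Qed.

Lemma hyp2F1_ge_1 (x : R) : 0 <= x < 1 -> 1 <= hyp2F1 a b 1 x.
Proof.
  intros Hx.
  assert (Ax : Rabs x < 1) by (rewrite Rabs_pos_eq; lra).
  rewrite hyp2F1_PSeries, PSeries_decr_1
    by (apply CV_radius_inside, hyp_coef_radius, Ax).
  assert (H0 : hyp_coef a b 0 = 1) by (unfold hyp_coef; simpl; field).
  assert (0 <= PSeries (PS_decr_1 (hyp_coef a b)) x).
  { replace 0 with (Series (fun n => 0 * x ^ n))
      by (rewrite Series_scal_l; ring).
    apply Series_le.
    - intros n; pose proof (hyp_coef_bounds a b (S n) Ha Hb).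
      pose proof (pow_le x n (proj1 Hx)).
      unfold PS_decr_1; split; nra.
    - apply ex_pseries_R, CV_radius_inside; rewrite CV_radius_decr_1.
      apply hyp_coef_radius, Ax. }
  nra.
Qed.

Lemma hyp2F1_0 : hyp2F1 a b 1 0 = 1.
Proof.
  rewrite hyp2F1_PSeries, PSeries_0; unfold hyp_coef; simpl; field.
Qed.

End Gauss.

(** * Self-adjoint equations and their pullbacks *)

(** [f] solves [(p f')' = Q f] at every point of [[0, l)]; the derivatives are
    two-sided, so [f] is regular at [0] even if [p 0 = 0]. *)
Definition solves (p Q : R -> R) (l : R) (f : R -> R) : Prop :=
  exists f1 phi : R -> R,
    forall t, 0 <= t < l ->
      is_derive f t (f1 t) /\ phi t = p t * f1 t /\ is_derive phi t (Q t * f t).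

Lemma is_derive_0_const (h : R -> R) (t : R) :
  0 <= t ->
  (forall s, 0 < s < t -> is_derive h s 0) ->
  (forall s, 0 <= s <= t -> continuity_pt h s) ->
  h t = h 0.
Proof.
  intros Ht D C.
  destruct (MVT_gen h 0 t (fun _ => 0)) as [c [_ E]].
  - rewrite Rmin_left, Rmax_right by lra; exact D.
  - rewrite Rmin_left, Rmax_right by lra; exact C.
  - lra.
Qed.

Lemma is_derive_continuity_pt (h : R -> R) (t d : R) :
  is_derive h t d -> continuity_pt h t.
Proof.
  intros D; apply continuity_pt_filterlim.
  apply (ex_derive_continuous h t); exists d; exact D.
Qed.

(** The Wronskian expression [p (f' g - f g')] has derivative zero and vanishes
    with [p] at [0]. *)
Lemma regular_solutions_proportional (p Q f g : R -> R) (l t : R) :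
  p 0 = 0 ->
  (forall s, 0 < s < l -> p s <> 0) ->
  (forall s, 0 <= s < l -> g s <> 0) ->
  solves p Q l f -> solves p Q l g ->
  0 <= t < l ->
  f t / g t = f 0 / g 0.
Proof.
  intros p0 pn gn [f1 [phi Hf]] [g1 [gam Hg]] Ht.
  set (W := fun s => phi s * g s - f s * gam s).
  assert (DW : forall s, 0 <= s < l -> is_derive W s 0).
  { intros s Hs; destruct (Hf s Hs) as [F1 [F2 F3]].
    destruct (Hg s Hs) as [G1 [G2 G3]].
    replace 0 with ((Q s * f s) * g s + phi s * g1 s
                    - (f1 s * gam s + f s * (Q s * g s)))
      by (rewrite F2, G2; ring).
    apply (is_derive_minus (fun s => phi s * g s) (fun s => f s * gam s)).
    - apply (is_derive_mult phi g s _ _ F3 G1 Rmult_comm).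
    - apply (is_derive_mult f gam s _ _ F1 G3 Rmult_comm). }
  assert (W0 : forall s, 0 <= s < l -> W s = 0).
  { intros s Hs; transitivity (W 0).
    - apply is_derive_0_const; [lra | |].
      + intros y Hy; apply DW; lra.
      + intros y Hy; apply (is_derive_continuity_pt W y 0), DW; lra.
    - unfold W; destruct (Hf 0) as [_ [F2 _]]; [lra|].
      destruct (Hg 0) as [_ [G2 _]]; [lra|].
      rewrite F2, G2, p0; ring. }
  assert (DR : forall s, 0 <= s < l ->
    is_derive (fun y => f y / g y) s ((f1 s * g s - f s * g1 s) / g s ^ 2)).
  { intros s Hs; apply is_derive_div.
    - apply (Hf s Hs).
    - apply (Hg s Hs).
    - apply gn, Hs. }
  apply (is_derive_0_const (fun s => f s / g s)); [lra | |].
  - intros s Hs.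
    replace 0 with ((f1 s * g s - f s * g1 s) / g s ^ 2); [apply DR; lra|].
    assert (E : W s = 0) by (apply W0; lra); unfold W in E.
    destruct (Hf s) as [_ [F2 _]]; [lra|].
    destruct (Hg s) as [_ [G2 _]]; [lra|].
    rewrite F2, G2 in E.
    assert (E' : f1 s * g s - f s * g1 s = 0).
    { apply (Rmult_eq_reg_l (p s)); [|apply pn; lra].
      rewrite Rmult_0_r, <- E; ring. }
    rewrite E'; unfold Rdiv; ring.
  - intros s Hs; eapply is_derive_continuity_pt, DR; lra.
Qed.

(** If [F] satisfies [(y (1 - y) F')' = m F], then [u F(x)] satisfies
    [(p f')' = Q f] as soon as [p u^2 x' = k x (1 - x)] and
    [Q = k m x' / u^2 + (p u')' / u].  The function [pu] stands for [p u']. *)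
Lemma pullback_solution (F F1 u u1 pu pu1 x x1 p Q : R -> R) (k m l : R) :
  (forall y, 0 <= y < 1 -> is_derive F y (F1 y)) ->
  (forall y, 0 <= y < 1 ->
     is_derive (fun z => z * (1 - z) * F1 z) y (m * F y)) ->
  (forall t, 0 <= t < l -> 0 <= x t < 1) ->
  (forall t, 0 <= t < l -> u t <> 0) ->
  (forall t, 0 <= t < l -> is_derive x t (x1 t)) ->
  (forall t, 0 <= t < l -> is_derive u t (u1 t)) ->
  (forall t, 0 <= t < l -> is_derive pu t (pu1 t)) ->
  (forall t, 0 <= t < l -> pu t = p t * u1 t) ->
  (forall t, 0 <= t < l -> p t * u t ^ 2 * x1 t = k * (x t * (1 - x t))) ->
  (forall t, 0 <= t < l -> Q t * u t ^ 2 = k * m * x1 t + pu1 t * u t) ->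
  solves p Q l (fun t => u t * F (x t)).
Proof.
  intros DF DF1 Hx Hu Dx Du Dpu Epu Ep EQ.
  exists (fun t => u1 t * F (x t) + u t * (x1 t * F1 (x t))).
  (* [p u x' F' = (k / u) x (1 - x) F'] *)
  exists (fun t => pu t * F (x t)
                   + k * / u t * (x t * (1 - x t) * F1 (x t))).
  intros t Ht.
  pose proof (Hx t Ht) as Hxt; pose proof (Hu t Ht) as Hut.
  assert (DFx : is_derive (fun s => F (x s)) t (x1 t * F1 (x t)))
    by (apply (is_derive_comp F x); auto).
  assert (DF1x : is_derive (fun s => x s * (1 - x s) * F1 (x s)) t
                   (x1 t * (m * F (x t))))
    by (apply (is_derive_comp (fun z => z * (1 - z) * F1 z) x); auto).
  assert (Dk : is_derive (fun s => k * / u s) t (k * (- u1 t / u t ^ 2)))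
    by (apply (is_derive_scal (fun s => / u s)), is_derive_inv; auto).
  split; [|split].
  - apply (is_derive_mult u (fun s => F (x s)) t _ _ (Du t Ht) DFx Rmult_comm).
  - rewrite Epu by exact Ht.
    replace (k * / u t * (x t * (1 - x t) * F1 (x t)))
      with (k * (x t * (1 - x t)) * (/ u t * F1 (x t))) by ring.
    rewrite <- Ep by exact Ht; field; exact Hut.
  - assert (E : Q t * (u t * F (x t))
      = (pu1 t * F (x t) + pu t * (x1 t * F1 (x t)))
        + (k * (- u1 t / u t ^ 2) * (x t * (1 - x t) * F1 (x t))
           + k * / u t * (x1 t * (m * F (x t))))).
    { rewrite Epu by exact Ht.
      replace (k * (- u1 t / u t ^ 2) * (x t * (1 - x t) * F1 (x t)))
        with (k * (x t * (1 - x t)) * (- u1 t / u t ^ 2 * F1 (x t))) by ring.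
      rewrite <- Ep by exact Ht.
      replace (Q t * (u t * F (x t)))
        with (Q t * u t ^ 2 * (/ u t * F (x t))) by (field; exact Hut).
      rewrite EQ by exact Ht; field; exact Hut. }
    rewrite E; apply (is_derive_plus (fun s => pu s * F (x s))
      (fun s => k * / u s * (x s * (1 - x s) * F1 (x s)))).
    + apply (is_derive_mult pu (fun s => F (x s)) t _ _ (Dpu t Ht) DFx Rmult_comm).
    + apply (is_derive_mult (fun s => k * / u s)
        (fun s => x s * (1 - x s) * F1 (x s)) t _ _ Dk DF1x Rmult_comm).
Qed.

(** * The two sides as solutions of one equation *)

(** The coefficients of the common equation [(p y')' = Q y]; [p] has a simple zero
    at [0] and at [1/3], and no zero in between. *)
Definition ode_p (t : R) : R := t * (1 - t ^ 2) * (1 - 9 * t ^ 2).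
Definition ode_Q (t : R) : R := 12 * t * (1 - 3 * t ^ 2).

(** The two arguments and prefactors in the variable [t = 1/r]; a factor [t^2]
    is removed from both prefactors. *)
Definition cubic_arg (t : R) : R :=
  27 * t ^ 4 * (1 - t ^ 2) / (1 - 3 * t ^ 2) ^ 3.
Definition cubic_factor (t : R) : R := / (1 - 3 * t ^ 2).
Definition elliptic_arg (t : R) : R :=
  16 * t ^ 3 / ((1 - t) ^ 3 * (1 + 3 * t)).
Definition elliptic_factor (t : R) : R := / sqrt ((1 - t) ^ 3 * (1 + 3 * t)).

Lemma cubic_arg_bounds (t : R) : 0 <= t < 1 / 3 -> 0 <= cubic_arg t < 1.
Proof.
  intros Ht; unfold cubic_arg.
  assert (H3 : 0 < 1 - 3 * t ^ 2) by nra.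
  assert (H1 : 0 < 1 - t ^ 2) by nra.
  assert (H9 : 0 < 1 - 9 * t ^ 2) by nra.
  pose proof (pow_lt _ 3 H3).
  pose proof (pow_le t 4 (proj1 Ht)).
  split.
  - apply Rdiv_le_0_compat; [nra | assumption].
  - apply Rlt_div_l; [assumption|].
    replace (1 * (1 - 3 * t ^ 2) ^ 3)
      with (27 * t ^ 4 * (1 - t ^ 2) + (1 - 9 * t ^ 2)) by ring.
    lra.
Qed.

Lemma elliptic_radicand_pos (t : R) :
  0 <= t < 1 / 3 -> 0 < (1 - t) ^ 3 * (1 + 3 * t).
Proof.
  intros Ht; apply Rmult_lt_0_compat; [apply pow_lt|]; lra.
Qed.

Lemma elliptic_arg_bounds (t : R) : 0 <= t < 1 / 3 -> 0 <= elliptic_arg t < 1.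
Proof.
  intros Ht; unfold elliptic_arg.
  pose proof (elliptic_radicand_pos t Ht).
  pose proof (pow_le t 3 (proj1 Ht)).
  split.
  - apply Rdiv_le_0_compat; lra.
  - apply Rlt_div_l; [assumption|].
    assert (0 < (1 + t) ^ 3 * (1 - 3 * t))
      by (apply Rmult_lt_0_compat; [apply pow_lt|]; lra).
    replace (1 * ((1 - t) ^ 3 * (1 + 3 * t)))
      with (16 * t ^ 3 + (1 + t) ^ 3 * (1 - 3 * t)) by ring.
    lra.
Qed.

Lemma cubic_side :
  solves ode_p ode_Q (1 / 3)
    (fun t => cubic_factor t * hyp2F1 (1 / 3) (2 / 3) 1 (cubic_arg t)).
Proof.
  assert (N : forall t, 0 <= t < 1 / 3 -> 1 - 3 * t ^ 2 <> 0) by (intros; nra).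
  apply (pullback_solution (hyp2F1 (1 / 3) (2 / 3) 1) (hyp_deriv (1 / 3) (2 / 3))
    cubic_factor (fun t => 6 * t / (1 - 3 * t ^ 2) ^ 2)
    (fun t => 6 * t ^ 2 * (1 - t ^ 2) * (1 - 9 * t ^ 2) / (1 - 3 * t ^ 2) ^ 2)
    (fun t => 12 * t * (1 - 17 * t ^ 2 + 27 * t ^ 4 - 27 * t ^ 6)
              / (1 - 3 * t ^ 2) ^ 3)
    cubic_arg (fun t => 108 * t ^ 3 / (1 - 3 * t ^ 2) ^ 4)
    ode_p ode_Q 4 (1 / 3 * (2 / 3)) (1 / 3)).
  - intros y Hy; apply is_derive_hyp2F1; try lra; rewrite Rabs_pos_eq; lra.
  - intros y Hy; apply is_derive_flux; try lra; rewrite Rabs_pos_eq; lra.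
  - exact cubic_arg_bounds.
  - intros t Ht; apply Rinv_neq_0_compat, N, Ht.
  - intros t Ht; unfold cubic_arg; specialize (N t Ht).
    auto_derive; [apply (pow_nonzero _ 3 N) | field; exact N].
  - intros t Ht; unfold cubic_factor; specialize (N t Ht).
    auto_derive; [exact N | field; exact N].
  - intros t Ht; specialize (N t Ht).
    auto_derive; [apply (pow_nonzero _ 2 N) | field; exact N].
  - intros t Ht; specialize (N t Ht); unfold ode_p; field; exact N.
  - intros t Ht; specialize (N t Ht); unfold ode_p, cubic_factor, cubic_arg.
    field; exact N.
  - intros t Ht; specialize (N t Ht); unfold ode_Q, cubic_factor; field; exact N.
Qed.

(** The square root only enters through its logarithmic derivative, which is
    rational: [v' / v = 6 t / ((1 - t) (1 + 3 t))]. *)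
Lemma is_derive_elliptic_factor (t : R) :
  0 <= t < 1 / 3 ->
  is_derive elliptic_factor t
    (6 * t / ((1 - t) * (1 + 3 * t)) * elliptic_factor t).
Proof.
  intros Ht; pose proof (elliptic_radicand_pos t Ht) as HR.
  pose proof (sqrt_lt_R0 _ HR) as HS.
  pose proof (sqrt_sqrt _ (Rlt_le _ _ HR)) as ES.
  set (rad1 := (- 3 * (1 - t) ^ 2 * (1 + 3 * t) + 3 * (1 - t) ^ 3)).
  set (S := sqrt ((1 - t) ^ 3 * (1 + 3 * t))) in *.
  assert (Dr : is_derive (fun s => (1 - s) ^ 3 * (1 + 3 * s)) t rad1)
    by (unfold rad1; auto_derive; [trivial | ring]).
  replace (6 * t / ((1 - t) * (1 + 3 * t)) * elliptic_factor t)
    with (- (rad1 / (2 * S)) / S ^ 2).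
  - apply (is_derive_inv (fun s => sqrt ((1 - s) ^ 3 * (1 + 3 * s)))).
    + apply (is_derive_sqrt (fun s => (1 - s) ^ 3 * (1 + 3 * s))); assumption.
    + fold S; lra.
  - unfold elliptic_factor; fold S.
    replace (S ^ 2) with ((1 - t) ^ 3 * (1 + 3 * t)) by (rewrite <- ES; ring).
    unfold rad1; field; repeat split; lra.
Qed.

Lemma elliptic_side :
  solves ode_p ode_Q (1 / 3)
    (fun t => elliptic_factor t * hyp2F1 (1 / 2) (1 / 2) 1 (elliptic_arg t)).
Proof.
  assert (V2 : forall t, 0 <= t < 1 / 3 ->
    elliptic_factor t ^ 2 = / ((1 - t) ^ 3 * (1 + 3 * t))).
  { intros t Ht; unfold elliptic_factor.
    rewrite pow_inv, pow2_sqrt; [reflexivity|].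
    apply Rlt_le, elliptic_radicand_pos, Ht. }
  apply (pullback_solution (hyp2F1 (1 / 2) (1 / 2) 1) (hyp_deriv (1 / 2) (1 / 2))
    elliptic_factor (fun t => 6 * t / ((1 - t) * (1 + 3 * t)) * elliptic_factor t)
    (fun t => 6 * t ^ 2 * (1 + t) * (1 - 3 * t) * elliptic_factor t)
    (fun t => (12 * t * (1 - 3 * t - 6 * t ^ 2)
       + 6 * t ^ 2 * (1 + t) * (1 - 3 * t) * (6 * t / ((1 - t) * (1 + 3 * t))))
       * elliptic_factor t)
    elliptic_arg
    (fun t => 48 * t ^ 2 * (1 + t) ^ 2 / ((1 - t) ^ 4 * (1 + 3 * t) ^ 2))
    ode_p ode_Q 3 (1 / 2 * (1 / 2)) (1 / 3)).
  - intros y Hy; apply is_derive_hyp2F1; try lra; rewrite Rabs_pos_eq; lra.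
  - intros y Hy; apply is_derive_flux; try lra; rewrite Rabs_pos_eq; lra.
  - exact elliptic_arg_bounds.
  - intros t Ht; apply Rinv_neq_0_compat, Rgt_not_eq, sqrt_lt_R0.
    apply elliptic_radicand_pos, Ht.
  - intros t Ht; unfold elliptic_arg.
    pose proof (elliptic_radicand_pos t Ht).
    auto_derive; [simpl in *; lra | field; split; lra].
  - exact is_derive_elliptic_factor.
  - intros t Ht.
    set (q := fun s => 6 * s ^ 2 * (1 + s) * (1 - 3 * s)).
    assert (Dq : is_derive q t (12 * t * (1 - 3 * t - 6 * t ^ 2)))
      by (unfold q; auto_derive; [trivial | ring]).
    pose proof (is_derive_mult q elliptic_factor t _ _ Dq
      (is_derive_elliptic_factor t Ht) Rmult_comm) as D.
    rewrite Rmult_plus_distr_r, (Rmult_assoc (6 * t ^ 2 * (1 + t) * (1 - 3 * t))).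
    exact D.
  - intros t Ht; unfold ode_p; field; lra.
  - intros t Ht; rewrite V2 by exact Ht; unfold ode_p, elliptic_arg.
    field; lra.
  - intros t Ht.
    rewrite (Rmult_assoc _ (elliptic_factor t) (elliptic_factor t)).
    replace (elliptic_factor t * elliptic_factor t)
      with (elliptic_factor t ^ 2) by ring.
    rewrite V2 by exact Ht; unfold ode_Q; field; lra.
Qed.

Lemma hyp2F1_cubic_elliptic (t : R) :
  0 <= t < 1 / 3 ->
  cubic_factor t * hyp2F1 (1 / 3) (2 / 3) 1 (cubic_arg t)
  = elliptic_factor t * hyp2F1 (1 / 2) (1 / 2) 1 (elliptic_arg t).
Proof.
  intros Ht.
  set (f := fun s => cubic_factor s * hyp2F1 (1 / 3) (2 / 3) 1 (cubic_arg s)).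
  set (g := fun s =>
    elliptic_factor s * hyp2F1 (1 / 2) (1 / 2) 1 (elliptic_arg s)).
  assert (Hg : forall s, 0 <= s < 1 / 3 -> g s <> 0).
  { intros s Hs; apply Rgt_not_eq, Rmult_lt_0_compat.
    - apply Rinv_0_lt_compat, sqrt_lt_R0, elliptic_radicand_pos, Hs.
    - apply Rlt_le_trans with 1; [lra|].
      apply hyp2F1_ge_1; try lra; apply elliptic_arg_bounds, Hs. }
  assert (E : f t / g t = f 0 / g 0).
  { apply (regular_solutions_proportional ode_p ode_Q f g (1 / 3)).
    - unfold ode_p; ring.
    - intros s Hs; unfold ode_p.
      apply Rgt_not_eq, Rmult_lt_0_compat; nra.
    - exact Hg.
    - exact cubic_side.
    - exact elliptic_side.
    - exact Ht. }
  assert (F0 : f 0 = 1).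
  { unfold f; replace (cubic_arg 0) with 0 by (unfold cubic_arg; field).
    rewrite hyp2F1_0; unfold cubic_factor; field. }
  assert (G0 : g 0 = 1).
  { unfold g; replace (elliptic_arg 0) with 0 by (unfold elliptic_arg; field).
    rewrite hyp2F1_0; unfold elliptic_factor.
    replace ((1 - 0) ^ 3 * (1 + 3 * 0)) with 1 by ring; rewrite sqrt_1; field. }
  rewrite F0, G0 in E.
  apply (Rmult_eq_reg_r (/ g t)); [|apply Rinv_neq_0_compat, Hg, Ht].
  fold (f t); fold (g t); rewrite Rinv_r by (apply Hg, Ht); lra.
Qed.

Lemma Rpower_3_2_1_2 (x y : R) :
  0 < x -> 0 < y -> Rpower x (3 / 2) * Rpower y (1 / 2) = sqrt (x ^ 3 * y).
Proof.
  intros Hx Hy.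
  replace (3 / 2) with (INR 3 * / 2) by (simpl; field).
  replace (1 / 2) with (/ 2) by field.
  pose proof (pow_lt x 3 Hx).
  rewrite <- Rpower_mult, Rpower_pow, !Rpower_sqrt, sqrt_mult; lra.
Qed.

Theorem corollary3p4 (r : R) (hr : 3 < r) :
  1 / (r ^ 2 - 3) *
    hyp2F1 (1 / 3) (2 / 3) 1 (27 * (r ^ 2 - 1) / (r ^ 2 - 3) ^ 3)
  = 1 / (Rpower (r - 1) (3 / 2) * Rpower (r + 3) (1 / 2)) *
    hyp2F1 (1 / 2) (1 / 2) 1 (16 * r / ((r - 1) ^ 3 * (r + 3))).
Proof.
  assert (Ht : 0 <= / r < 1 / 3).
  { split.
    - apply Rlt_le, Rinv_0_lt_compat; lra.
    - replace (1 / 3) with (/ 3) by field; apply Rinv_lt_contravar; lra. }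
  pose proof (hyp2F1_cubic_elliptic (/ r) Ht) as E.
  assert (H3 : 0 < r ^ 2 - 3) by nra.
  pose proof (elliptic_radicand_pos (/ r) Ht) as HR.
  replace (27 * (r ^ 2 - 1) / (r ^ 2 - 3) ^ 3) with (cubic_arg (/ r))
    by (unfold cubic_arg; field; split; nra).
  replace (16 * r / ((r - 1) ^ 3 * (r + 3))) with (elliptic_arg (/ r))
    by (unfold elliptic_arg; field; repeat split; lra).
  rewrite Rpower_3_2_1_2 by lra.
  replace ((r - 1) ^ 3 * (r + 3))
    with ((r ^ 2) ^ 2 * ((1 - / r) ^ 3 * (1 + 3 * / r))) by (field; lra).
  rewrite sqrt_mult, sqrt_pow2; try nra.
  assert (HS := sqrt_lt_R0 _ HR).
  replace (1 / (r ^ 2 - 3)) with (/ r ^ 2 * cubic_factor (/ r))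
    by (unfold cubic_factor; field; split; nra).
  rewrite Rmult_assoc, E; unfold elliptic_factor; field; split; lra.
Qed.
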